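(* Let $G\curvearrowright M$ and $H\curvearrowright N$ be oligomorphic permutation groups. (1) If $G$ and $H$ have approximable random endomorphisms, then so do the direct product $G\times H$ and the wreath product $G\wr H$. (2) If $G$ is a finite index supergroup of $H$ and $H$ has approximable random endomorphisms, then so does $G$. (3) If $G$ has approximable random endomorphisms and $G\simeq H$ as topological groups, then $H$ has approximable random endomorphisms.
   Context: A permutation group $G\curvearrowright X$ means: $X$ is a countable set and $G$ is a closed subgroup of $\mathrm{Sym}(X)$ (topology of pointwise convergence, $X$ discrete). It is oligomorphic if $G$ has finitely many orbits on $X^n$ for every $n$. An $\aleph_0$-categorical structure $M$ is identified with the oligomorphic permutation group $\mathrm{Aut}(M)\curvearrowright M$; the semigroup $\mathrm{End}(M)$ of elementary self-embeddings of $M$ is then the left-completion $\overline{G}$ of $G=\mathrm{Aut}(M)$, that is, the closure of $G$ in $X^X$ (with $X=M$) for the topology of pointwise convergence. Random variables. $\Omega=[0,1]$ and $\Omega^2=[0,1]^2$ carry their Borel $\sigma$-algebras and Lebesgue measures $\mu$. For a Polish space $Z$ (a countable set being discrete), $Z^{\Omega}$ and $Z^{\Omega^2}$ denote the spaces of measurable functions from $\Omega$, resp. $\Omega^2$, to $Z$ up to a.e. equality; $Z^{\Omega}$ is identified with the elements of $Z^{\Omega^2}$ depending only on the first coordinate. For a countable set $X$, $X^{\Omega^2}$ has the metric $d(f,f')=\mu\{x\in\Omega^2: f(x)\neq f'(x)\}$. For a permutation group $G\curvearrowright X$, $\overline{G}^{\Omega^2}$ (and so $G^{\Omega^2}\subseteq\overline{G}^{\Omega^2}$)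 acts on $X^{\Omega^2}$ by $(\hat{h}f)(x)=\hat{h}(x)(f(x))$. An oligomorphic permutation group $G\curvearrowright X$ has approximable random endomorphisms if for every $\hat{h}\in\overline{G}^{\Omega^2}$ and every $\epsilon>0$ there is $\hat{g}\in G^{\Omega^2}$ such that $d(\hat{g}(f),\hat{h}(f))<\epsilon$ for every $f\in X^{\Omega}$ (viewed inside $X^{\Omega^2}$). Constructions, for permutation groups $G\curvearrowright M$ and $H\curvearrowright N$. The direct product is the permutation group $G\times H\curvearrowright M\sqcup N$ with $(g,h)a=ga$ if $a\in M$ and $(g,h)b=hb$ if $b\in N$. The wreath product $G\wr H$ is the permutation group $H\ltimes G^N\curvearrowright N\times M$ with $(h,g)(b,a)=(hb,g(b)a)$; here $H$ acts on $G^N$ on the right by $(g\cdot h)(b)=g(hb)$, and the group law is $(h,g)(h',g')=(hh',(g\cdot h')g')$. $G$ is a finite index supergroup of $H$ if $M=N$, $H\leq G$ and $[G:H]<\infty$. *)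

(* Defs.v *)
From mathcomp Require Import all_boot all_order all_algebra.
From mathcomp Require Import all_classical all_reals all_analysis.

Set Implicit Arguments.
Unset Strict Implicit.
Unset Printing Implicit Defensive.

Import Order.TTheory GRing.Theory Num.Theory.
Import numFieldNormedType.Exports.

Local Open Scope classical_set_scope.
Local Open Scope ring_scope.

(* X^X, with the topology of pointwise convergence, X being discrete *)
Notation self_map X := {ptws X -> discrete_topology X}.

Definition Sym (X : countType) : set (self_map X) := [set f | bijective f].

(* [closed] is relative to Sym X, whose topology is the one induced by X^X. *)
Record permutation_group (X : countType) (G : set (self_map X)) : Prop := {
  perm_group_sub : G `<=` @Sym X;
  perm_group_id : G idfun;
  perm_group_comp : forall f g : self_map X, G f -> G g -> G (f \o g);
  perm_group_inv : forall f g : self_map X, G f -> cancel f g -> cancel g f -> G g;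
  perm_group_closed : closed (G : set (subspace (@Sym X)))
}.

Definition orbit (X : countType) (G : set (self_map X)) (n : nat)
    (t : n.-tuple X) : set (n.-tuple X) :=
  [set map_tuple g t | g in G].

Definition oligomorphic (X : countType) (G : set (self_map X)) : Prop :=
  forall n, finite_set [set orbit G t | t in [set: n.-tuple X]].

Definition oligomorphic_permutation_group (X : countType)
    (G : set (self_map X)) : Prop :=
  permutation_group G /\ oligomorphic G.

Definition left_completion (X : countType) (G : set (self_map X)) :
    set (self_map X) :=
  closure G.

Section RandomVariables.
Context {R : realType}.

Definition Omega : set (measurableTypeR R) := `[0, 1]%classic.

Definition Omega2 : set (measurableTypeR R * measurableTypeR R) :=
  Omega `*` Omega.

(* Representatives of the D-indexed random variables with values in the
   subspace C of Z, that is, of C^D: Borel maps, not yet quotiented by a.e.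
   equality.  The first clause is
   [measurable_fun D (f : T -> g_sigma_algebraType (@open Z))] unfolded, since
   measurable types are pointed in the library whereas Z may be empty. *)
Definition random_elements d (T : measurableType d) (D : set T)
    (Z : topologicalType) (C : set Z) : set (T -> Z) :=
  [set f | (forall B, <<s @open Z >> B -> measurable (D `&` f @^-1` B)) /\
           (forall w, D w -> C (f w))].

(* The metric on X^{Omega^2} *)
Definition rv_dist (X : countType)
    (f f' : measurableTypeR R * measurableTypeR R -> X) : \bar R :=
  (lebesgue_measure \x lebesgue_measure)%E
    (Omega2 `&` [set w | f w <> f' w]).

(* The action of (X^X)^{Omega^2} on X^{Omega^2} *)
Definition rv_act (X : countType)
    (h : measurableTypeR R * measurableTypeR R -> self_map X)
    (f : measurableTypeR R * measurableTypeR R -> X) :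
    measurableTypeR R * measurableTypeR R -> X :=
  fun w => h w (f w).

End RandomVariables.

(* f : Omega -> X is viewed in X^{Omega^2} as [f \o fst]. *)
Definition approximable_random_endomorphisms (R : realType) (X : countType)
    (G : set (self_map X)) : Prop :=
  oligomorphic_permutation_group G /\
  forall h, random_elements (@Omega2 R) (left_completion G) h ->
  forall eps : R, 0 < eps ->
  exists2 g, random_elements (@Omega2 R) G g &
    forall f, random_elements (@Omega R) [set: discrete_topology X] f ->
      (rv_dist (rv_act g (f \o fst)) (rv_act h (f \o fst)) < eps%:E)%E.

Definition direct_product (M N : countType) (G : set (self_map M))
    (H : set (self_map N)) : set (self_map (M + N)%type) :=
  [set k | exists g h, [/\ G g, H h &
    k = fun x => match x with inl a => inl (g a) | inr b => inr (h b) end]].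

(* The image in Sym(N * M) of the semidirect product of H and G^N *)
Definition wreath_product (M N : countType) (G : set (self_map M))
    (H : set (self_map N)) : set (self_map (N * M)%type) :=
  [set k | exists (h : self_map N) (g : N -> self_map M),
    [/\ H h, forall b, G (g b) & k = fun x => (h x.1, g x.1 x.2)]].

Definition finite_index_supergroup (M : countType) (G H : set (self_map M)) :
    Prop :=
  H `<=` G /\ finite_set [set [set g \o h | h in H] | g in G].

Definition topologically_isomorphic (M N : countType) (G : set (self_map M))
    (H : set (self_map N)) : Prop :=
  exists (phi : self_map M -> self_map N) (psi : self_map N -> self_map M),
    [/\ [/\ set_fun G H phi, set_fun H G psi,
            {in G, cancel phi psi} & {in H, cancel psi phi}],
        forall f g : self_map M, G f -> G g -> phi (f \o g) = phi f \o phi g,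
        {within G, continuous phi} & {within H, continuous psi}].

(* Main.v *)
Require Import Defs.
From mathcomp Require Import all_boot all_order all_algebra.
From mathcomp Require Import all_classical all_reals all_analysis.

Set Implicit Arguments.
Unset Strict Implicit.
Unset Printing Implicit Defensive.

Import Order.TTheory GRing.Theory Num.Theory.

Local Open Scope classical_set_scope.

(** All the constructions live on the closure of the group in X^X, and a point
of that closure is known only through its values on finite sets. Two facts make
this workable. Since X is countable, a map into X^X is a random element as soon
as each of its evaluations has measurable fibres ([random_self_mapP]). And an
approximation that is good against every random point of X is, with a smaller
error, good against every random list of points of X of bounded length
([approximable_on_seqs]): the disagreement on a list of length at most n is
covered by n disagreements on points.

Direct and wreath products. An element of the closure of the product splits
into coordinates, each of which lies in the closure of a factor and depends
locally on the element: two coordinates for G x H; one in the closure of H and,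
for each b in N, one in the closure of G for the wreath product. The
coordinates are approximated separately, the i-th one with error of order
e / 2^i, and the approximations are glued. A random point of the product space
asks each coordinate for its value on a list with at most one element, so the
total error is at most the sum of the errors ([rv_dist_cover_lt]).

Finite index. If G is the union of r_0 H, ..., r_{n-1} H, then its closure is
the union of the translates by the r_i of the closure of H. A measurable choice
of the coset ([dmeasurable_choice]) translates a random element of the closure
of G into one of the closure of H; an approximation of the latter is translated
back, without changing the set of disagreement.

Topological isomorphism. Let phi : G -> H be the isomorphism and psi its
inverse. Both are uniformly continuous ([within_continuous_modulus]), so psi
extends to the closures ([extend_to_closure]) and turns a random element h of
the closure of H into one of the closure of G, which is approximated by some g;
then phi o g approximates h. Indeed phi (g w) b is controlled by the values of
g w on a finite list a(b), and because H has finitely many orbits on the set it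
acts on, the lists a(b) can be taken of bounded length: for k in H, a list for
k b is the translate by psi k of a list for b ([bounded_modulus]). *)

(** * Pointwise convergence on a countable set *)

Definition cylinder (X : countType) (s : seq X) (f : self_map X) :
  set (self_map X) := [set g | {in s, f =1 g}].

Lemma cylinder_filter (X : countType) (f : self_map X) :
  Filter [set U | exists s, cylinder s f `<=` U].
Proof.
split=> /=; first by exists [::].
- move=> U V [s sU] [t tV]; exists (s ++ t) => g fg.
  by split; [apply: sU | apply: tV] => x xs; apply: fg;
    rewrite mem_cat xs ?orbT.
- by move=> U V UV [s sU]; exists s; exact: subset_trans UV.
Qed.

(** The sets containing a cylinder around f form a filter that converges to f
pointwise, hence for the product topology. *)
Lemma nbhs_cylinderP (X : countType) (f : self_map X) (U : set (self_map X)) :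
  nbhs f U <-> exists s, cylinder s f `<=` U.
Proof.
split=> [|[s]].
- have FF := cylinder_filter f.
  suff: cvg_to [set V | exists s, cylinder s f `<=` V] (nbhs f) by exact.
  apply/(@pointwise_cvgP (discrete_topology X) (discrete_topology X)) => x /= V.
  move=> Vfx; exists [:: x] => g /(_ x); rewrite inE => /(_ (eqxx x)) fg.
  by rewrite /= -fg; exact: nbhs_singleton Vfx.
- move=> sU; apply: (filterS sU); elim: s {sU} => [|x s IHs].
    by apply: (@filterE _ (nbhs f)) => g x.
  have fx : nbhs f [set g : self_map X | f x = g x].
    have fx1 : nbhs (f x : discrete_topology X) [set f x].
      exact/principal_filterP.
    have := @proj_continuous X (fun=> discrete_topology X) x f _ fx1.
    by apply: (@filterS _ (nbhs f)) => g; exact: esym.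
  apply: (@filterS _ (nbhs f)) (filterI fx IHs) => g [fgx fgs] y.
  by rewrite inE => /predU1P[-> //|]; exact: fgs.
Qed.

Lemma closureP (X : countType) (G : set (self_map X)) (f : self_map X) :
  closure G f <-> forall s : seq X, exists2 g, G g & {in s, f =1 g}.
Proof.
split=> [Gf s|Gf U /nbhs_cylinderP[s sU]].
- have /Gf[g [Gg fg]] : nbhs f (cylinder s f) by apply/nbhs_cylinderP; exists s.
  by exists g.
- by have [g Gg fg] := Gf s; exists g; split=> //; exact: sU.
Qed.

Lemma closed_SymP (X : countType) (G : set (self_map X)) :
  G `<=` @Sym X ->
  closed (G : set (subspace (@Sym X))) <->
  forall f : self_map X, bijective f -> closure G f -> G f.
Proof.
move=> GS; rewrite closed_subspaceP; split=> [[V cV VG] f bf Gf|cG].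
- suff: (G `&` @Sym X) f by case.
  rewrite -VG; split=> //; apply: cV; apply: closureS Gf.
  move=> g Gg; have [] //: (V `&` @Sym X) g.
  by rewrite VG; split=> //; exact: GS.
- exists (closure G); first exact: closed_closure.
  rewrite eqEsubset; split=> f [Gf bf]; split=> //; first exact: cG.
  exact: subset_closure.
Qed.

(** * Random elements of countable spaces and of spaces of self-maps *)

Section Discrete.
Context d (T : measurableType d) (D : set T) (mD : measurable D).

(** Measurability for the discrete structure on X, without requiring a point in
X as the measurable types do. *)
Definition dmeasurable (X : countType) (f : T -> X) :=
  forall P : set X, measurable (D `&` f @^-1` P).

(** Evaluating a random family at a random index stays measurable because there
are only countably many indices. Pairing, and the action of a random map on a
random point, are instances. *)
Lemma dmeasurable_bind (X Y : countType) (f : T -> X) (F : X -> T -> Y) :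
  dmeasurable f -> (forall x, dmeasurable (F x)) ->
  dmeasurable (fun w => F (f w) w).
Proof.
move=> mf mF P.
rewrite (_ : _ `&` _ =
    \bigcup_x ((D `&` f @^-1` [set x]) `&` (D `&` F x @^-1` P))).
  apply: countable_bigcupT_measurable; first exact: countableP.
  by move=> x; apply: measurableI; [exact: mf|exact: mF].
rewrite eqEsubset; split=> w /=; first by move=> [Dw Pw]; exists (f w).
by move=> [x _ [[Dw <-]] [_ Pw]].
Qed.

Lemma dmeasurable_cst (X : countType) (x : X) : dmeasurable (fun=> x).
Proof.
move=> P; have [Px|Px] := pselect (P x).
- by rewrite (_ : _ `&` _ = D) // eqEsubset; split=> w // [].
- by rewrite (_ : _ `&` _ = set0) // eqEsubset; split=> w // [].
Qed.

Lemma dmeasurable_comp (X Y : countType) (k : X -> Y) (f : T -> X) :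
  dmeasurable f -> dmeasurable (k \o f).
Proof. by move=> mf P; exact: (mf (k @^-1` P)). Qed.

Lemma dmeasurable_pair (X Y : countType) (f : T -> X) (g : T -> Y) :
  dmeasurable f -> dmeasurable g -> dmeasurable (fun w => (f w, g w)).
Proof.
move=> mf mg; apply: (@dmeasurable_bind _ _ f (fun x w => (x, g w))) => // x.
exact: (dmeasurable_comp (pair x)).
Qed.

Lemma dmeasurable_map (X Y : countType) (h : T -> X -> Y) (s : seq X) :
  (forall x, dmeasurable (h^~ x)) -> dmeasurable (fun w => map (h w) s).
Proof.
move=> mh; elim: s => [|x s IHs]; first exact: dmeasurable_cst.
exact: (dmeasurable_comp (fun p => p.1 :: p.2)
                         (dmeasurable_pair (mh x) IHs)).
Qed.

Lemma dmeasurableP (X : countType) (f : T -> X) :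
  (forall x, measurable (D `&` f @^-1` [set x])) -> dmeasurable f.
Proof.
move=> mf P.
rewrite (_ : _ `&` _ = \bigcup_x (D `&` f @^-1` ([set x] `&` P))).
  apply: countable_bigcupT_measurable; first exact: countableP.
  move=> x; have [Px|Px] := pselect (P x).
    rewrite (_ : [set x] `&` P = [set x]); first exact: mf.
    by apply/setIidl => _ ->.
  rewrite (_ : [set x] `&` P = set0) ?preimage_set0 ?setI0 //.
  by apply/seteqP; split=> y // [-> /Px].
rewrite eqEsubset; split=> w /=; first by move=> [Dw Pw]; exists (f w).
by move=> [x _ [Dw [_ Pw]]].
Qed.

Lemma sigma_algebra_preimage_on (Z : Type) (f : T -> Z) :
  sigma_algebra setT [set B | measurable (D `&` f @^-1` B)].
Proof.
split=> /=; first by rewrite preimage_set0 setI0.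
- move=> A mA; rewrite (_ : _ `&` _ = D `\` (D `&` f @^-1` A)).
    exact: measurableD.
  by rewrite eqEsubset; split=> w /=; tauto.
- move=> F mF; rewrite preimage_bigcup setI_bigcupr.
  exact: bigcup_measurable.
Qed.

Lemma random_discreteP (X : countType) (f : T -> X) :
  random_elements D [set: discrete_topology X] f <-> dmeasurable f.
Proof.
split=> [[mf _] P|mf].
- by apply: mf; apply: sub_sigma_algebra; exact: discrete_open.
- by split=> // B _; exact: mf.
Qed.

(** The basic open sets of X^X prescribe finitely many values, so there are
countably many of them, and the Borel sets are generated by the evaluations. *)
Lemma random_self_mapP (X : countType) (C : set (self_map X))
    (h : T -> self_map X) :
  random_elements D C h <->
  (forall x, dmeasurable (h^~ x)) /\ (forall w, D w -> C (h w)).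
Proof.
split=> [[mh Ch]|[mh Ch]]; split=> //.
- move=> x P; apply: (mh [set k | P (k x)]); apply: sub_sigma_algebra => /=.
  rewrite openE => k Pkx; apply/nbhs_cylinderP; exists [:: x] => g /(_ x).
  by rewrite inE => /(_ (eqxx x)) /= <-.
- move=> B; apply: (smallest_sub (sigma_algebra_preimage_on h)) => U oU /=.
  (* an open set is the union of the countably many boxes it contains *)
  pose box (st : seq X * seq X) := [set k : self_map X | map k st.1 = st.2].
  rewrite (_ : _ `&` _ =
      \bigcup_st (D `&` h @^-1` (box st `&` [set k | box st `<=` U]))).
    apply: countable_bigcupT_measurable; first exact: countableP.
    move=> st; have [stU|stU] := pselect (box st `<=` U); last first.
      by rewrite (_ : _ `&` _ = set0) // eqEsubset; split=> w // [_ []].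
    rewrite (_ : _ `&` _ = D `&` (fun w => map (h w) st.1) @^-1` [set st.2]).
      exact: dmeasurable_map.
    by rewrite eqEsubset; split=> w /=; rewrite /box /=; tauto.
  rewrite eqEsubset; split=> w /=; last first.
    by move=> [st _ [Dw [hst]]]; split; auto.
  move=> [Dw Uw]; rewrite openE in oU; have /nbhs_cylinderP[s sU] := oU _ Uw.
  exists (s, map (h w) s) => //.
  split=> //; split=> // k; rewrite /box /= => /eq_in_map hk; apply: sU => x xs.
  by rewrite hk.
Qed.

(** Under uniform continuity of [theta] on A, each value of [theta k] is read off
from the values of k on a finite set, hence, for random k, from a measurable map
into the countable set of lists. *)
Lemma random_local (X Y : countType) (A : set (self_map X))
    (B : set (self_map Y)) (theta : self_map X -> self_map Y)
    (h : T -> self_map X) :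
  set_fun A B theta ->
  (forall y, exists s : seq X, forall k k', A k -> A k' -> {in s, k =1 k'} ->
     theta k y = theta k' y) ->
  random_elements D A h -> random_elements D B (theta \o h).
Proof.
move=> AB loc /random_self_mapP[mh Ah]; apply/random_self_mapP.
split=> [y P|w /Ah /AB//].
have [s sy] := loc y.
rewrite (_ : _ `&` _ = D `&` (fun w => map (h w) s) @^-1`
    [set t | exists k, [/\ A k, map k s = t & P (theta k y)]]).
  exact: dmeasurable_map.
rewrite eqEsubset; split=> w /= [Dw].
  by move=> Pw; split=> //; exists (h w); split=> //; exact: Ah.
move=> [k [Ak /eq_in_map ks Pk]]; split=> //.
by rewrite -(sy k) //; exact: Ah.
Qed.

(** The least admissible index is a measurable selection. *)
Lemma dmeasurable_choice (E : nat -> set T) :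
  (forall i, measurable (D `&` E i)) -> (forall w, D w -> exists i, E i w) ->
  exists2 c : T -> nat, dmeasurable c & forall w, D w -> E (c w) w.
Proof.
move=> mE DE.
have DE' w : exists i, `[<D w -> E i w>].
  have [/DE[i Ei]|Dw] := pselect (D w); first by exists i; apply/asboolP.
  by exists 0%N; apply/asboolP.
exists (fun w => ex_minn (DE' w)) => [|w Dw]; last first.
  by case: ex_minnP => i /asboolP/(_ Dw).
apply: dmeasurableP => i.
rewrite (_ : _ `&` _ = (D `&` E i) `\` \big[setU/set0]_(j < i) (D `&` E j)).
  apply: measurableD; first exact: mE.
  by apply: bigsetU_measurable => j _; exact: mE.
rewrite -(bigcup_mkord _ (fun j => D `&` E j)) eqEsubset; split=> w /=.
- move=> [Dw]; case: ex_minnP => k /asboolP/(_ Dw) Ek kmin <-.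
  split=> // -[j /= jk [_ Ej]]; move: jk; rewrite ltnNge kmin //.
  exact/asboolP.
- move=> [[Dw Ei] nE]; split=> //; case: ex_minnP => k.
  move=> /asboolP/(_ Dw) Ek kmin.
  have ki : (k <= i)%N by apply: kmin; exact/asboolP.
  apply/eqP; rewrite eqn_leq ki /= leqNgt; apply/negP => ltki; apply: nE.
  by exists k.
Qed.
End Discrete.

(** * Sets of disagreement *)

Section Measure.
Context (R : realType).
Local Notation T1 := (measurableTypeR R).
Local Notation T2 := (T1 * T1)%type.
Local Notation mu :=
  (lebesgue_measure \x lebesgue_measure : set T2 -> \bar R)%E.

Lemma measurable_Omega : measurable (@Omega R).
Proof. exact: measurable_itv. Qed.

Lemma measurable_Omega2 : measurable (@Omega2 R).
Proof. by apply: measurableX; exact: measurable_Omega. Qed.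

Lemma dmeasurable_fst (X : countType) (f : T1 -> X) :
  dmeasurable (@Omega R) f -> dmeasurable (@Omega2 R) (f \o fst).
Proof.
move=> mf P; rewrite (_ : _ `&` _ = (@Omega R `&` f @^-1` P) `*` @Omega R).
  by apply: measurableX; [exact: mf|exact: measurable_Omega].
by rewrite eqEsubset; split=> w /=; rewrite /Omega2 /=; tauto.
Qed.

(** Countable subadditivity, with errors that form a geometric series indexed by
an arbitrary countable type. *)
Lemma measure_cover_le (I : countType) (A : set T2) (E : I -> set T2) (e : R) :
  (0 <= e)%R -> measurable A -> (forall i, measurable (E i)) ->
  (forall i, (mu (E i) <= (e / (2 ^ (pickle i).+1)%:R)%:E)%E) ->
  A `<=` \bigcup_i E i -> (mu A <= e%:E)%E.
Proof.
move=> e0 mA mE Ee AE.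
pose F n := if @unpickle I n is Some i then
  if pickle i == n then E i else set0 else set0.
have mF n : measurable (F n).
  by rewrite /F; case: unpickle => [i|//]; case: ifP.
apply: (@le_trans _ _ (\sum_(0 <= n <oo) mu (F n))%E).
  apply: measure_sigma_subadditive => // w /AE[i _ Ei].
  by exists (pickle i) => //; rewrite /F pickleK eqxx.
apply: le_trans (@epsilon_trick0 R e xpredT e0).
apply: lee_nneseries => [n _ _|n _]; first exact: measure_ge0.
rewrite /F; case: unpickle => [i|]; first case: eqP => [<- //|_].
  all: by rewrite measure0 lee_fin divr_ge0.
Qed.

(** The pairs of lists of values are compared, rather than values at single
points, so that the condition is an equation between random elements of a
countable set. *)
Definition disagreement (X : countType) (g h : T2 -> self_map X)
    (l : T1 -> seq X) : set T2 :=
  @Omega2 R `&` [set w | map (g w) (l w.1) <> map (h w) (l w.1)].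

Lemma measurable_disagreement (X : countType) (C C' : set (self_map X))
    (g h : T2 -> self_map X) (l : T1 -> seq X) :
  random_elements (@Omega2 R) C g -> random_elements (@Omega2 R) C' h ->
  dmeasurable (@Omega R) l -> measurable (disagreement g h l).
Proof.
move=> /(random_self_mapP measurable_Omega2)[mg _].
move=> /(random_self_mapP measurable_Omega2)[mh _] /dmeasurable_fst ml.
apply: (dmeasurable_bind (F := fun s w => (map (g w) s, map (h w) s)) ml _
  [set p | p.1 <> p.2]) => s.
by apply: dmeasurable_pair; apply: dmeasurable_map => //;
  exact: measurable_Omega2.
Qed.

Lemma agree_off_disagreement (X : countType) (g h : T2 -> self_map X)
    (l : T1 -> seq X) (w : T2) :
  @Omega2 R w -> ~ disagreement g h l w -> {in l w.1, g w =1 h w}.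
Proof.
by move=> Ow ngh; apply/eq_in_map; apply: contrapT => ghw; exact: ngh.
Qed.

(** The list is read entry by entry; e / 2^n is at most each of the first n terms
of the series e / 2^(i+1) of [measure_cover_le]. *)
Lemma approximable_on_seqs (X : countType) (G : set (self_map X))
    (h : T2 -> self_map X) (n : nat) (e : R) :
  approximable_random_endomorphisms R G ->
  random_elements (@Omega2 R) (left_completion G) h -> (0 < e)%R ->
  exists2 g, random_elements (@Omega2 R) G g &
    forall l, dmeasurable (@Omega R) l -> (forall x, (size (l x) <= n)%N) ->
      (mu (disagreement g h l) <= e%:E)%E.
Proof.
move=> [_ aG] rh e0.
have [|g rg gh] := aG h rh (e / (2 ^ n)%:R)%R.
  by rewrite divr_gt0// ltr0n expn_gt0.
exists g => // l ml ln.
have mgh := measurable_disagreement rg rh.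
have [[x0]|X0] := pselect (inhabited X); last first.
  rewrite (_ : disagreement _ _ _ = set0) ?measure0 ?lee_fin ?ltW //.
  apply/seteqP; split=> // w [_ ghw]; apply: ghw.
  by case: (l w.1) => // x; case: X0; exact: inhabits.
have ml1 i := dmeasurable_comp (fun s : seq X => [:: nth x0 s i]) ml.
(* Beyond the end of the list the default entry x0 is read: this can only
   enlarge the cover. *)
pose E i := if (i < n)%N then disagreement g h (fun x => [:: nth x0 (l x) i])
            else set0.
apply: (@measure_cover_le nat _ E) => //; first exact: ltW.
- exact: mgh.
- by move=> i; rewrite /E; case: ifP => // _; apply: mgh; exact: ml1.
- move=> i; rewrite /E; case: ifP => [lein|_]; last first.
    by rewrite measure0 lee_fin divr_ge0 // ltW.
  apply: (@le_trans _ _ (e / (2 ^ n)%:R)%:E); last first.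
    rewrite lee_fin ler_pM2l // lef_pV2 ?posrE ?ltr0n ?expn_gt0 //.
    by rewrite ler_nat leq_exp2l.
  apply: le_trans (ltW (gh (fun x => nth x0 (l x) i) _)); last first.
    apply/random_discreteP.
    exact: (dmeasurable_comp (fun s : seq X => nth x0 s i) ml).
  rewrite le_eqVlt; apply/orP; left; apply/eqP; congr (mu _).
  rewrite eqEsubset; split=> w /= [Ow]; rewrite /rv_act /= => ghw; split=> //.
    by apply: contra_not ghw => ->.
  by case.
- move=> w [Ow ghw].
  have /hasP[x xl ghx] : has (fun x => g w x != h w x) (l w.1).
    apply/negPn; rewrite -all_predC; apply/negP => /allP ghE; apply: ghw.
    by apply/eq_in_map => x /ghE /= /negPn/eqP.
  have il : (index x (l w.1) < size (l w.1))%N by rewrite index_mem.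
  exists (index x (l w.1)) => //; rewrite /E (leq_trans il) //; split=> //=.
  by rewrite nth_index // => -[/eqP]; rewrite (negPf ghx).
Qed.

(** The form in which approximations are glued: g and h agree wherever none of
the coordinates indexed by I disagrees. Halving e makes the bound strict. *)
Lemma rv_dist_cover_lt (X : countType) (C C' : set (self_map X))
    (g h : T2 -> self_map X) (f : T1 -> X)
    (I : countType) (E : I -> set T2) (e : R) :
  random_elements (@Omega2 R) C g -> random_elements (@Omega2 R) C' h ->
  random_elements (@Omega R) [set: discrete_topology X] f -> (0 < e)%R ->
  (forall i, measurable (E i)) ->
  (forall i, (mu (E i) <= (e / 2 / (2 ^ (pickle i).+1)%:R)%:E)%E) ->
  (forall w, (@Omega2 R) w -> (forall i, ~ E i w) ->
     g w (f w.1) = h w (f w.1)) ->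
  (rv_dist (rv_act g (f \o fst)) (rv_act h (f \o fst)) < e%:E)%E.
Proof.
move=> rg rh /random_discreteP mf e0 mE Ee fE.
have mf1 := dmeasurable_comp (fun x => [:: x]) mf.
apply: (@le_lt_trans _ _ (e / 2)%:E); last first.
  by rewrite lte_fin ltr_pdivrMr // ltr_pMr // ltr1n.
apply: (@measure_cover_le I _ E) => //; first by rewrite divr_ge0 // ltW.
  rewrite (_ : _ `&` _ = disagreement g h (fun x => [:: f x])).
    exact: measurable_disagreement rg rh mf1.
  rewrite eqEsubset; split=> w /= [Ow]; rewrite /rv_act /= => ghw; split=> //.
    by case.
  by apply: contra_not ghw => ->.
move=> w [Ow /= ghw]; apply: contrapT => nE; apply: ghw; apply: fE => // i Ei.
by apply: nE; exists i.
Qed.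

End Measure.

(** * Permutation groups and finite colourings *)

(** The form in which groups are built: closure under two-sided inverses already
gives the inclusion in Sym X. *)
Lemma permutation_groupP (X : countType) (G : set (self_map X)) :
  permutation_group G <->
  [/\ G idfun, forall f g : self_map X, G f -> G g -> G (f \o g),
      forall f, G f -> exists2 g, G g & cancel f g /\ cancel g f
    & forall f : self_map X, bijective f -> closure G f -> G f].
Proof.
split=> [[GS G1 GM GV]|[G1 GM GV cG]].
  move/closed_SymP => cG; split=> // [f Gf|]; last exact: cG.
  have [g fg gf] := GS _ Gf; exists g => //; exact: GV Gf fg gf.
have GS : G `<=` @Sym X by move=> f /GV[g _ [fg gf]]; exists g.
split=> //; last exact/closed_SymP.
move=> f g /GV[g' Gg' [fg' gf']] fg gf; rewrite (_ : g = g') //.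
by apply/funext => x; rewrite -{1}(gf' x) fg.
Qed.

Lemma closure_inj (X : countType) (G : set (self_map X)) (f : self_map X) :
  G `<=` @Sym X -> closure G f -> injective f.
Proof.
move=> GS /closureP Gf x y; have [g /GS/bij_inj gI fg] := Gf [:: x; y].
by rewrite !fg ?inE ?eqxx ?orbT //; exact: gI.
Qed.

Lemma finite_image_reps (T U : Type) (F : T -> U) (A : set T) (a0 : T) :
  A a0 -> finite_set (F @` A) ->
  exists (n : nat) (r : nat -> T), (forall i, A (r i)) /\
    forall a, A a -> exists2 i, (i < n)%N & F (r i) = F a.
Proof.
move=> Aa0 /finite_setP[n /card_set_bijP[u [uF uI _]]].
have /boolp.choice[r rP] i : exists a, A a /\
    ((exists2 b, A b & u (F b) = i) -> u (F a) = i).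
  have [[b Ab ub]|nb] := pselect (exists2 b, A b & u (F b) = i).
    by exists b.
  by exists a0; split=> // /nb.
exists n, r; split=> [i|a Aa]; first by case: (rP i).
exists (u (F a)); first by apply: uF; exists a.
have [Ara ua] := rP (u (F a)).
by apply: uI; rewrite ?inE; [exists (r (u (F a)))|exists a|apply: ua; exists a].
Qed.

(** Finiteness of the number of orbits amounts to a finite colouring of n-tuples
that separates the orbits. Colourings that are finer than the partition into
orbits are allowed: this frees product constructions from counting orbits. *)
Lemma oligomorphicP (X : countType) (G : set (self_map X)) :
  permutation_group G ->
  oligomorphic G <-> forall n, exists (C : finType) (c : ('I_n -> X) -> C),
    forall u v, c u = c v -> exists2 g, G g & forall i, g (u i) = v i.
Proof.
move=> /permutation_groupP[G1 GM GV _]; split=> oG n.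
- have [[t0]|X0] := pselect (inhabited (n.-tuple X)); last first.
    exists unit, (fun=> tt) => u; case: X0; exact: (inhabits (mktuple u)).
  have [m [r [_ rP]]] := finite_image_reps (I : [set: n.-tuple X] t0) (oG n).
  have /boolp.choice[c cP] (u : 'I_n -> X) : exists i : 'I_m,
      Defs.orbit G (r i) = Defs.orbit G (mktuple u).
    by have [i ltim ri] := rP (mktuple u) I; exists (Ordinal ltim).
  exists 'I_m, c => u v cuv.
  have [g Gg guv] : Defs.orbit G (mktuple u) (mktuple v).
    rewrite -cP cuv cP; exists idfun => //.
    by apply: eq_from_tnth => i; rewrite tnth_map.
  exists g => // i; have := congr1 (fun t => tnth t i) guv.
  by rewrite tnth_map !tnth_mktuple.
- have [C [c cP]] := oG n.
  pose F x := if pselect (exists t : n.-tuple X, c (tnth t) = x) is left tx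
    then Defs.orbit G (projT1 (cid tx)) else set0.
  apply: (@sub_finite_set _ _ (F @` [set: C])); last exact: finite_image.
  move=> _ [t _ <-]; exists (c (tnth t)) => //; rewrite /F.
  case: pselect => [tx|[]]; last by exists t.
  case: cid => s /= cst.
  have sub s' t' : c (tnth s') = c (tnth t') ->
      Defs.orbit G t' `<=` Defs.orbit G s'.
    move=> /cP[g Gg gst] _ [k Gk <-]; exists (k \o g); first exact: GM.
    by apply: eq_from_tnth => i; rewrite !tnth_map /= gst.
  by rewrite eqEsubset; split; exact: sub.
Qed.

(** Undefined entries are filled with one chosen point of X; a group element that
matches the filled tuples matches the entries that are defined in both. *)
Lemma oligomorphic_partial (X : countType) (G : set (self_map X)) (n : nat) :
  permutation_group G -> oligomorphic G ->
  exists (C : finType) (c : ('I_n -> option X) -> C), forall u v, c u = c v ->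
    exists2 g, G g & forall i x y, u i = Some x -> v i = Some y -> g x = y.
Proof.
move=> pG oG; have /permutation_groupP[G1 _ _ _] := pG.
have [[x0]|X0] := pselect (inhabited X); last first.
  exists unit, (fun=> tt) => u v _; exists idfun => // i x.
  by case: X0; exact: inhabits.
have [C [c cP]] := (oligomorphicP pG).1 oG n.
exists C, (fun u => c (fun i => odflt x0 (u i))) => u v /cP[g Gg guv].
by exists g => // i x y ux vy; move: (guv i); rewrite ux vy.
Qed.

(** * Direct products *)

Section DirectProduct.
Context (M N : countType) (G : set (self_map M)) (H : set (self_map N)).
Hypotheses (pG : permutation_group G) (pH : permutation_group H).

Definition sum_map (g : self_map M) (h : self_map N) : self_map (M + N)%type :=
  fun x => match x with inl a => inl (g a) | inr b => inr (h b) end.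

(** Elements of the closure of a direct product preserve both summands, so the
default branch is never reached on them; likewise for [right_part]. *)
Definition left_part (k : self_map (M + N)%type) : self_map M :=
  fun a => if k (inl a) is inl a' then a' else a.

Definition right_part (k : self_map (M + N)%type) : self_map N :=
  fun b => if k (inr b) is inr b' then b' else b.

Lemma closure_direct_product (k : self_map (M + N)%type) :
  closure (direct_product G H) k ->
  [/\ closure G (left_part k), closure H (right_part k)
    & k = sum_map (left_part k) (right_part k)].
Proof.
move=> /closureP kGH; split.
- apply/closureP => s; have [_ [g [h [Gg Hh ->]]] kgh] := kGH (map inl s).
  by exists g => // a sa; rewrite /left_part kgh ?map_f.
- apply/closureP => s; have [_ [g [h [Gg Hh ->]]] kgh] := kGH (map inr s).
  by exists h => // b sb; rewrite /right_part kgh ?map_f.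
- apply/funext => x; have [_ [g [h [Gg Hh ->]]] kgh] := kGH [:: x].
  by case: x kgh => x kgh; rewrite /sum_map /left_part /right_part kgh ?inE.
Qed.

Lemma sum_map_bij (g : self_map M) (h : self_map N) :
  bijective (sum_map g h) -> bijective g /\ bijective h.
Proof.
move=> [k gk kg]; split.
- exists (left_part k) => x; first by rewrite /left_part (gk (inl x)).
  by rewrite /left_part; case: (k _) (kg (inl x)) => //= a [].
- exists (right_part k) => x; first by rewrite /right_part (gk (inr x)).
  by rewrite /right_part; case: (k _) (kg (inr x)) => //= a [].
Qed.

Lemma permutation_group_direct_product :
  permutation_group (direct_product G H).
Proof.
have /permutation_groupP[G1 GM GV cG] := pG.
have /permutation_groupP[H1 HM HV cH] := pH.
apply/permutation_groupP; split.
- by exists idfun, idfun; split=> //; apply/funext; case.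
- move=> _ _ [g [h [Gg Hh ->]]] [g' [h' [Gg' Hh' ->]]].
  exists (g \o g'), (h \o h'); split; [exact: GM|exact: HM|].
  by apply/funext; case.
- move=> _ [g [h [Gg Hh ->]]].
  have [g' Gg' [gg' g'g]] := GV _ Gg; have [h' Hh' [hh' h'h]] := HV _ Hh.
  exists (sum_map g' h'); first by exists g', h'.
  by split; case=> x /=; rewrite ?gg' ?g'g ?hh' ?h'h.
- move=> k bk /closure_direct_product[Gk Hk kE].
  rewrite kE in bk; have [bl br] := sum_map_bij bk.
  by exists (left_part k), (right_part k); split; [exact: cG|exact: cH|].
Qed.

Lemma oligomorphic_direct_product :
  oligomorphic G -> oligomorphic H -> oligomorphic (direct_product G H).
Proof.
move=> oG oH; apply/oligomorphicP.
  exact: permutation_group_direct_product.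
move=> n.
have [C [c cP]] := oligomorphic_partial n pG oG.
have [D [d dP]] := oligomorphic_partial n pH oH.
pose inM (x : M + N) := if x is inl a then Some a else None.
pose inN (x : M + N) := if x is inr b then Some b else None.
exists ({ffun 'I_n -> bool} * (C * D))%type.
exists (fun u => ([ffun i => isSome (inM (u i))],
                  (c (inM \o u), d (inN \o u)))) => u v.
move=> [/ffunP side /cP[g Gg guv] /dP[h Hh huv]].
exists (sum_map g h); first by exists g, h.
move=> i; move: (side i) (guv i) (huv i); rewrite !ffunE /=.
case: (u i) => [a|b]; case: (v i) => [a'|b'] //= _ ga hb.
  by rewrite (ga _ a').
by rewrite (hb _ b').
Qed.

Lemma approximable_direct_product (R : realType) :
  approximable_random_endomorphisms R G ->
  approximable_random_endomorphisms R H ->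
  approximable_random_endomorphisms R (direct_product G H).
Proof.
move=> aG aH; split.
  split; first exact: permutation_group_direct_product.
  by apply: oligomorphic_direct_product; [case: aG => -[]|case: aH => -[]].
move=> k rk e e0; have mO := @measurable_Omega2 R.
have rkM : random_elements (@Omega2 R) (left_completion G) (left_part \o k).
  apply: (random_local mO) rk => // [? /closure_direct_product[]//|a].
  exists [:: inl a] => k1 k2 _ _ k12.
  by rewrite /left_part k12 ?inE.
have rkN : random_elements (@Omega2 R) (left_completion H) (right_part \o k).
  apply: (random_local mO) rk => // [? /closure_direct_product[]//|b].
  exists [:: inr b] => k1 k2 _ _ k12.
  by rewrite /right_part k12 ?inE.
pose d (i : bool) : R := (e / 2 / (2 ^ (pickle i).+1)%:R)%R.
have d0 i : (0 < d i)%R by rewrite !divr_gt0 // ltr0n expn_gt0.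
have [g rg gk] := approximable_on_seqs 1 aG rkM (d0 true).
have [h rh hk] := approximable_on_seqs 1 aH rkN (d0 false).
have [mg Gg] := (random_self_mapP mO _ _).1 rg.
have [mh Hh] := (random_self_mapP mO _ _).1 rh.
have rgh : random_elements (@Omega2 R) (direct_product G H)
    (fun w => sum_map (g w) (h w)).
  apply/random_self_mapP => //; split=> [[a|b]|w Ow].
  - exact: (dmeasurable_comp inl (mg a)).
  - exact: (dmeasurable_comp inr (mh b)).
  - by exists (g w), (h w); split; [exact: Gg|exact: Hh|].
exists (fun w => sum_map (g w) (h w)) => // f rf.
have /random_discreteP mf := rf.
pose inM (x : M + N) := if x is inl a then [:: a] else [::].
pose inN (x : M + N) := if x is inr b then [:: b] else [::].
have mfM := dmeasurable_comp inM mf; have mfN := dmeasurable_comp inN mf.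
pose E (i : bool) := if i then disagreement g (left_part \o k) (inM \o f)
                     else disagreement h (right_part \o k) (inN \o f).
apply: (rv_dist_cover_lt rgh rk rf e0 (E := E)) => [[]|[]|w Ow nE].
- exact: measurable_disagreement rg rkM mfM.
- exact: measurable_disagreement rh rkN mfN.
- by apply: gk => // x /=; case: (f x).
- by apply: hk => // x /=; case: (f x).
have Kk := ((random_self_mapP mO _ _).1 rk).2 w Ow.
have [_ _ kE] := closure_direct_product Kk.
have gkw := agree_off_disagreement Ow (nE true).
have hkw := agree_off_disagreement Ow (nE false).
rewrite kE; move: gkw hkw => /=; case: (f w.1) => [a|b] gkw hkw /=.
  by rewrite (gkw a) ?inE.
by rewrite (hkw b) ?inE.
Qed.

End DirectProduct.

(** * Wreath products *)

Section WreathProduct.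
Context (M N : countType) (G : set (self_map M)) (H : set (self_map N)).
Hypotheses (pG : permutation_group G) (pH : permutation_group H).

Definition wreath_map (h : self_map N) (g : N -> self_map M) :
  self_map (N * M)%type := fun x => (h x.1, g x.1 x.2).

Definition base_part (a0 : M) (k : self_map (N * M)%type) : self_map N :=
  fun b => (k (b, a0)).1.

Definition fibre_part (k : self_map (N * M)%type) (b : N) : self_map M :=
  fun a => (k (b, a)).2.

Lemma closure_wreath_product (a0 : M) (k : self_map (N * M)%type) :
  closure (wreath_product G H) k ->
  [/\ closure H (base_part a0 k), forall b, closure G (fibre_part k b)
    & k = wreath_map (base_part a0 k) (fibre_part k)].
Proof.
move=> /closureP kGH; split=> [|b|].
- apply/closureP => s.
  have [_ [h [g [Hh _ ->]]] khg] := kGH (map (pair^~ a0) s).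
  by exists h => // b sb; rewrite /base_part khg ?map_f.
- apply/closureP => s.
  have [_ [h [g [_ Gg ->]]] khg] := kGH (map (pair b) s).
  by exists (g b) => // a sa; rewrite /fibre_part khg ?map_f.
- apply/funext => -[b a].
  have [_ [h [g [_ _ ->]]] khg] := kGH [:: (b, a); (b, a0)].
  by rewrite /wreath_map /base_part /fibre_part !khg ?inE ?eqxx ?orbT.
Qed.

(** Surjectivity of the parts follows from that of the whole, but injectivity of
h does not, and without it a point above h b could come from a fibre other than
that of b. *)
Lemma wreath_map_bij (a0 : M) (h : self_map N) (g : N -> self_map M) :
  injective h -> (forall b, injective (g b)) -> bijective (wreath_map h g) ->
  bijective h /\ forall b, bijective (g b).
Proof.
move=> hI gI [k _ kK].
have k1 b a : h (k (b, a)).1 = b by have /(congr1 fst) := kK (b, a).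
have k2 b a : g (k (b, a)).1 (k (b, a)).2 = a.
  by have /(congr1 snd) := kK (b, a).
split=> [|b].
- by exists (fun b => (k (b, a0)).1) => [|b //]; exact: inj_can_sym hI.
- exists (fun a => (k (h b, a)).2); last first.
    by move=> a; rewrite -[X in g X](hI _ _ (k1 (h b) a)).
  apply: inj_can_sym (gI b) => a.
  by rewrite -[X in g X](hI _ _ (k1 (h b) a)).
Qed.

Lemma permutation_group_wreath_product :
  permutation_group (wreath_product G H).
Proof.
have /permutation_groupP[G1 GM GV cG] := pG.
have /permutation_groupP[H1 HM HV cH] := pH.
have K1 : wreath_product G H idfun.
  by exists idfun, (fun=> idfun); split=> //; apply/funext => -[].
apply/permutation_groupP; split=> //.
- move=> _ _ [h [g [Hh Gg ->]]] [h' [g' [Hh' Gg' ->]]].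
  exists (h \o h'), (fun b => g (h' b) \o g' b).
  by split=> // [|b]; [exact: HM|exact: GM].
- move=> _ [h [g [Hh Gg ->]]]; have [h' Hh' [hh' h'h]] := HV _ Hh.
  have /boolp.choice[g' g'P] b :
      exists g', G g' /\ (cancel (g b) g' /\ cancel g' (g b)).
    by have [g' Gg' gg'] := GV _ (Gg b); exists g'.
  exists (wreath_map h' (fun b => g' (h' b))).
    by exists h', (fun b => g' (h' b)); split=> // b; have [] := g'P (h' b).
  split=> -[b a]; rewrite /wreath_map /= ?hh' ?h'h.
    by have [_ [-> _]] := g'P b.
  by have [_ [_ ->]] := g'P (h' b).
- move=> k bk; have [[a0]|M0] := pselect (inhabited M); last first.
    move=> _; rewrite (_ : k = idfun) //; apply/funext => -[b a].
    by case: M0; exact: inhabits.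
  move=> /(closure_wreath_product a0)[Hk Gk kE].
  have [|||bh bg] := @wreath_map_bij a0 (base_part a0 k) (fibre_part k).
  + by apply: closure_inj Hk; case: pH.
  + by move=> b; apply: closure_inj (Gk b); case: pG.
  + by rewrite -kE.
  by exists (base_part a0 k), (fibre_part k); split=> // [|b];
    [exact: cH|exact: cG].
Qed.

(** A tuple of pairs is coloured by the colour of its projection to N and, for
each index j, by the colour of the partial tuple of those entries that lie in
the same fibre as the j-th one. The element of H that matches the projections
sends fibres to fibres, and on each fibre that occurs an element of G is chosen
from the colour of an index in that fibre. *)
Lemma oligomorphic_wreath_product :
  oligomorphic G -> oligomorphic H -> oligomorphic (wreath_product G H).
Proof.
move=> oG oH; apply/oligomorphicP.
  exact: permutation_group_wreath_product.
move=> n.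
have [C [c cP]] := oligomorphic_partial n pG oG.
have [D [d dP]] := (oligomorphicP pH).1 oH n.
pose fib (u : 'I_n -> N * M) (j : 'I_n) (i : 'I_n) :=
  if (u i).1 == (u j).1 then Some (u i).2 else None.
exists (D * {ffun 'I_n -> C})%type.
exists (fun u => (d (fst \o u), [ffun j => c (fib u j)])) => u v.
move=> [/dP[h Hh /= huv] /ffunP cuv].
have /boolp.choice[g gP] j : exists g, G g /\
    forall i x y, fib u j i = Some x -> fib v j i = Some y -> g x = y.
  have /cP[g Gg guv] : c (fib u j) = c (fib v j).
    by move: (cuv j); rewrite !ffunE.
  by exists g.
have G1 : G idfun by case: pG.
pose g' b := if [pick j | (u j).1 == b] is Some j then g j else idfun.
exists (wreath_map h g') => [|i].
  exists h, g'; split=> // b; rewrite /g'; case: pickP => // j _.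
  by have [] := gP j.
rewrite /wreath_map (surjective_pairing (v i)) -huv; congr pair.
rewrite /g'; case: pickP => [j /eqP uij|/(_ i)]; last by rewrite eqxx.
have [_ gj] := gP j; apply: (gj i); rewrite /fib ?uij ?eqxx //.
by rewrite -!huv uij eqxx.
Qed.

Lemma approximable_wreath_product (R : realType) :
  approximable_random_endomorphisms R G ->
  approximable_random_endomorphisms R H ->
  approximable_random_endomorphisms R (wreath_product G H).
Proof.
move=> aG aH; split.
  split; first exact: permutation_group_wreath_product.
  by apply: oligomorphic_wreath_product; [case: aG => -[]|case: aH => -[]].
move=> k rk e e0; have mO := @measurable_Omega2 R.
have [[a0]|M0] := pselect (inhabited M); last first.
  have NM0 : N * M -> False by case=> b a; apply: M0; exact: inhabits.
  exists k => [|f _].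
    have [mk Kk] := (random_self_mapP mO _ _).1 rk.
    apply/random_self_mapP => //; split=> // w /Kk.
    by move=> /closureP/(_ [::])[k' Kk' _]; rewrite (_ : k w = k') //;
      apply/funext => x; case: (NM0 x).
  rewrite /rv_dist (_ : _ `&` _ = set0) ?measure0 ?lte_fin //.
  by apply/seteqP; split=> // w; case: (NM0 (f w.1)).
have rkN : random_elements (@Omega2 R) (left_completion H) (base_part a0 \o k).
  apply: (random_local mO) rk => // [? /(closure_wreath_product a0)[]//|b].
  exists [:: (b, a0)] => k1 k2 _ _ k12.
  by rewrite /base_part k12 ?inE.
have rkM b : random_elements (@Omega2 R) (left_completion G)
    ((fibre_part^~ b) \o k).
  apply: (random_local mO) rk => [k' /(closure_wreath_product a0)[_ Gk _]|a].
    exact: Gk.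
  exists [:: (b, a)] => k1 k2 _ _ k12.
  by rewrite /fibre_part k12 ?inE.
pose d (i : option N) : R := (e / 2 / (2 ^ (pickle i).+1)%:R)%R.
have d0 i : (0 < d i)%R by rewrite !divr_gt0 // ltr0n expn_gt0.
have [h rh hk] := approximable_on_seqs 1 aH rkN (d0 None).
have /boolp.choice[g gP] b : exists g, random_elements (@Omega2 R) G g /\
    forall l, dmeasurable (@Omega R) l -> (forall x, (size (l x) <= 1)%N) ->
    ((lebesgue_measure \x lebesgue_measure)%E
      (disagreement g ((fibre_part^~ b) \o k) l) <= (d (Some b))%:E)%E.
  have [g rg gk] := approximable_on_seqs 1 aG (rkM b) (d0 (Some b)).
  by exists g.
have rg b := (gP b).1; have gk b := (gP b).2.
have [mh Hh] := (random_self_mapP mO _ _).1 rh.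
have mg b := ((random_self_mapP mO _ _).1 (rg b)).1.
have Gg b := ((random_self_mapP mO _ _).1 (rg b)).2.
have rhg : random_elements (@Omega2 R) (wreath_product G H)
    (fun w => wreath_map (h w) (fun b => g b w)).
  apply/random_self_mapP => //; split=> [[b a]|w Ow].
  - exact: dmeasurable_pair (mh b) (mg b a).
  - by exists (h w), (fun b => g b w); split=> // [|b]; [exact: Hh|exact: Gg].
exists (fun w => wreath_map (h w) (fun b => g b w)) => // f rf.
have /random_discreteP mf := rf.
pose inN (x : N * M) := [:: x.1].
pose inM b (x : N * M) := if x.1 == b then [:: x.2] else [::].
have mfN := dmeasurable_comp inN mf; have mfM b := dmeasurable_comp (inM b) mf.
pose E (i : option N) :=
  if i is Some b then disagreement (g b) ((fibre_part^~ b) \o k) (inM b \o f)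
  else disagreement h (base_part a0 \o k) (inN \o f).
apply: (rv_dist_cover_lt rhg rk rf e0 (E := E)) => [[b|]|[b|]|w Ow nE].
- exact: measurable_disagreement (rg b) (rkM b) (mfM b).
- exact: measurable_disagreement rh rkN mfN.
- by apply: gk => // x /=; rewrite /inM; case: ifP.
- by apply: hk.
have Kk := ((random_self_mapP mO _ _).1 rk).2 w Ow.
have [_ _ kE] := closure_wreath_product a0 Kk.
have hkw := agree_off_disagreement Ow (nE None).
have gkw := agree_off_disagreement Ow (nE (Some (f w.1).1)).
rewrite kE /wreath_map; congr pair; first by apply: hkw; rewrite inE.
by apply: gkw; rewrite /inM /= eqxx inE.
Qed.

End WreathProduct.

(** * Finite index supergroups *)

(** The closure of a finite union is the union of the closures: finite sets that
witness that f is outside each of them are merged into one. *)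
Lemma closure_finite_cosets (X : countType) (G H : set (self_map X)) (n : nat)
    (r q : nat -> self_map X) (f : self_map X) :
  (forall i, cancel (r i) (q i)) ->
  (forall g, G g -> exists2 i, (i < n)%N & exists2 h, H h & r i \o h = g) ->
  closure G f -> exists i, closure H (q i \o f).
Proof.
move=> rq Gr /closureP Gf; apply: contrapT => nHf.
have /boolp.choice[s sP] i : exists s : seq X,
    forall h, H h -> ~ {in s, q i \o f =1 h}.
  apply: contrapT => ns; apply: nHf; exists i; apply/closureP => s.
  by apply: contrapT => nh; apply: ns; exists s => h Hh fh; apply: nh; exists h.
have [g Gg fg] := Gf (flatten (map s (iota 0 n))).
have [i ltin [h Hh rh]] := Gr _ Gg.
apply: (sP i h Hh) => x xs /=; rewrite fg -?rh /= ?rq //.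
by apply/flatten_mapP; exists i => //; rewrite mem_iota.
Qed.

Lemma approximable_finite_index (R : realType) (X : countType)
    (G H : set (self_map X)) :
  oligomorphic_permutation_group G -> finite_index_supergroup G H ->
  approximable_random_endomorphisms R H ->
  approximable_random_endomorphisms R G.
Proof.
move=> oG [HG fGH] aH; split=> // h rh e e0; have mO := @measurable_Omega2 R.
have [/permutation_groupP[G1 GM GV _] _] := oG.
have [/permutation_groupP[H1 _ _ _] _] := aH.1.
have [n [r [Gr rP]]] := finite_image_reps G1 fGH.
have /boolp.choice[q qP] i :
    exists q : self_map X, cancel (r i) q /\ cancel q (r i).
  by have [q _ rq] := GV _ (Gr i); exists q.
have rq i := (qP i).1; have qr i := (qP i).2.
have [mh Gh] := (random_self_mapP mO _ _).1 rh.
have [||c mc cP] := @dmeasurable_choice _ _ (@Omega2 R)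
    (fun i => [set w | closure H (q i \o h w)]).
- move=> i; have [+ _] : random_elements (@Omega2 R)
      [set: self_map X] (fun w => q i \o h w : self_map X).
    apply/random_self_mapP => //; split=> // x.
    exact: (dmeasurable_comp (q i) (mh x)).
  apply; rewrite -[closure H]setCK -setTD; apply: sigma_algebraCD.
  by apply: sub_sigma_algebra; apply: closed_openC; exact: closed_closure.
- move=> w /Gh; apply: (closure_finite_cosets (n := n) rq) => g Gg.
  have [i ltin rg] := rP _ Gg; exists i => //.
  suff: [set r i \o k | k in H] g by [].
  by rewrite rg; exists idfun.
have rqh : random_elements (@Omega2 R) (left_completion H)
    (fun w => q (c w) \o h w : self_map X).
  apply/random_self_mapP => //; split=> // x.
  apply: (dmeasurable_bind (F := fun i w => q i (h w x)) mc) => i.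
  exact: (dmeasurable_comp (q i) (mh x)).
have [g rg gqh] := aH.2 _ rqh _ e0.
have [mg Hg] := (random_self_mapP mO _ _).1 rg.
exists (fun w => r (c w) \o g w : self_map X).
  apply/random_self_mapP => //; split=> [x|w Ow].
    apply: (dmeasurable_bind (F := fun i w => r i (g w x)) mc) => i.
    exact: (dmeasurable_comp (r i) (mg x)).
  by apply: GM; [exact: Gr|apply: HG; exact: Hg].
move=> f rf; have := gqh f rf.
rewrite /rv_dist; set A := (X in (_ X < _)%E -> _).
set B := (X in _ -> (_ X < _)%E); suff -> : A = B by [].
rewrite /A /B eqEsubset; split=> w [Ow]; rewrite /rv_act /= => ghw; split=> //.
  by apply: contra_not ghw => /= <-; rewrite rq.
by apply: contra_not ghw => /= ->; rewrite qr.
Qed.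

(** * Topologically isomorphic groups *)

(** Continuity at the identity gives a finite set whose pointwise stabiliser
does not move the value at y; translating by g makes that set work everywhere,
which is uniform continuity for the left uniformity. *)
Lemma within_continuous_modulus (X Y : countType) (G : set (self_map X))
    (theta : self_map X -> self_map Y) :
  permutation_group G -> {within G, continuous theta} ->
  (forall f g, G f -> G g -> theta (f \o g) = theta f \o theta g) ->
  forall y, exists s : seq X, forall g g', G g -> G g' -> {in s, g =1 g'} ->
    theta g y = theta g' y.
Proof.
move=> /permutation_groupP[G1 GM GV _] ct tM y.
have U1 : nbhs (theta idfun) (cylinder [:: y] (theta idfun)).
  by apply/nbhs_cylinderP; exists [:: y].
have := ct idfun _ U1.
rewrite /nbhs /= -nbhs_subspace_in // => /nbhs_cylinderP[s sU].
exists s => g g' Gg Gg' gg'.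
have [k Gk [gk kg]] := GV _ Gg.
have tk : theta idfun y = theta (k \o g') y.
  apply: (sU (k \o g') _ (GM _ _ Gk Gg') y); last exact: mem_head.
  by move=> x xs /=; rewrite -gg' ?gk.
rewrite (_ : g' = g \o (k \o g')); last by apply/funext => x /=; rewrite kg.
rewrite tM //=; last exact: GM.
by rewrite -tk; have /(congr1 (@^~ y)) /= <- := tM _ _ Gg G1.
Qed.

(** A modulus for b is transported to one for h b by psi h, without changing its
length, so representatives of the finitely many orbits on Y suffice. *)
Lemma bounded_modulus (X Y : countType) (G : set (self_map X))
    (H : set (self_map Y)) (phi : self_map X -> self_map Y)
    (psi : self_map Y -> self_map X) :
  permutation_group G -> permutation_group H -> oligomorphic H ->
  set_fun H G psi -> {in H, cancel psi phi} ->
  (forall f g, G f -> G g -> phi (f \o g) = phi f \o phi g) ->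
  (forall y, exists s : seq X, forall g g', G g -> G g' -> {in s, g =1 g'} ->
    phi g y = phi g' y) ->
  exists (n : nat) (a : Y -> seq X), forall y, (size (a y) <= n)%N /\
    forall g g', G g -> G g' -> {in a y, g =1 g'} -> phi g y = phi g' y.
Proof.
move=> /permutation_groupP[G1 GM GV _] /permutation_groupP[H1 HM HV _] oH.
move=> HG psiK pM loc.
have [[y0]|Y0] := pselect (inhabited Y); last first.
  by exists 0%N, (fun=> [::]) => y; case: Y0; exact: inhabits.
have [m [r [_ rP]]] :=
  finite_image_reps (I : [set: 1.-tuple Y] [tuple y0]) (oH 1%N).
have /boolp.choice[s sP] := loc.
pose b i := tnth (r i) ord0.
pose n := \max_(i < m) size (s (b i)).
suff /boolp.choice[a aP] y : exists t, (size t <= n)%N /\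
    forall g g', G g -> G g' -> {in t, g =1 g'} -> phi g y = phi g' y.
  by exists n, a.
have [i ltim ri] := rP [tuple y] I.
have [h Hh hbi] : exists2 h, H h & h (b i) = y.
  have [h Hh hr] : Defs.orbit H (r i) [tuple y].
    rewrite ri; exists idfun => //.
    by apply: eq_from_tnth => j; rewrite tnth_map.
  by exists h => //; have := congr1 (fun t => tnth t ord0) hr; rewrite tnth_map.
have Gh := HG _ Hh.
exists (map (psi h) (s (b i))); split.
  rewrite size_map.
  exact: (@leq_bigmax _ (fun i : 'I_m => size (s (b i))) (Ordinal ltim)).
move=> g g' Gg Gg' gg'.
have := sP (b i) (g \o psi h) (g' \o psi h) (GM _ _ Gg Gh) (GM _ _ Gg' Gh).
rewrite (pM _ _ Gg Gh) (pM _ _ Gg' Gh) psiK ?inE //= hbi; apply => x xs /=.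
by apply: gg'; exact: map_f.
Qed.

(** The value at y of the extension at k is that of [theta] at any element of G
that agrees with k on the finite set s y; such an element exists when k is in
the closure of G. *)
Lemma extend_to_closure (X Y : countType) (G : set (self_map X))
    (H : set (self_map Y)) (theta : self_map X -> self_map Y)
    (s : Y -> seq X) :
  set_fun G H theta ->
  (forall y g g', G g -> G g' -> {in s y, g =1 g'} -> theta g y = theta g' y) ->
  exists thetab : self_map X -> self_map Y,
    [/\ set_fun (closure G) (closure H) thetab,
        forall y k k', closure G k -> closure G k' -> {in s y, k =1 k'} ->
          thetab k y = thetab k' y
      & forall k y g, closure G k -> G g -> {in s y, k =1 g} ->
          thetab k y = theta g y].
Proof.
move=> GH loc.
have /boolp.choice[tb tbP] k : exists l : self_map Y, forall y g,
    closure G k -> G g -> {in s y, k =1 g} -> l y = theta g y.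
  suff /boolp.choice[l lP] y : exists z, forall g,
      closure G k -> G g -> {in s y, k =1 g} -> z = theta g y by exists l.
  have [Gk|nk] := pselect (closure G k); last by exists y.
  have [g Gg kg] := (closureP _ _).1 Gk (s y).
  exists (theta g y) => g' _ Gg' kg'; apply: loc => // x xs.
  by rewrite -kg ?kg'.
exists tb; split=> [k Gk|y k k' Gk Gk' kk'|k y g]; last exact: tbP.
- apply/closureP => t.
  have [g Gg kg] := (closureP _ _).1 Gk (flatten (map s t)).
  exists (theta g); first exact: GH.
  move=> y yt; apply: tbP => // x xs; apply: kg.
  by apply/flatten_mapP; exists y.
- have [g Gg k'g] := (closureP _ _).1 Gk' (s y).
  rewrite (tbP k y g) // ?(tbP k' y g) // => x xs.
  by rewrite kk' ?k'g.
Qed.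

Lemma approximable_isomorphic (R : realType) (X Y : countType)
    (G : set (self_map X)) (H : set (self_map Y)) :
  oligomorphic_permutation_group H -> topologically_isomorphic G H ->
  approximable_random_endomorphisms R G ->
  approximable_random_endomorphisms R H.
Proof.
move=> oH [phi [psi [[GH HG phiK psiK] phiM cphi cpsi]]] aG.
split=> // h rh e e0; have mO := @measurable_Omega2 R.
have [pG _] := aG.1; have [pH olH] := oH.
have phi_mod := within_continuous_modulus pG cphi phiM.
have [n [a aP]] := bounded_modulus pG pH olH HG psiK phiM phi_mod.
have psiM f g : H f -> H g -> psi (f \o g) = psi f \o psi g.
  move=> Hf Hg; have Gf := HG _ Hf; have Gg := HG _ Hg.
  have -> : f \o g = phi (psi f \o psi g).
    by rewrite (phiM _ _ Gf Gg) !psiK ?inE.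
  by rewrite phiK // inE; exact: (perm_group_comp pG).
have /boolp.choice[s sP] := within_continuous_modulus pH cpsi psiM.
have [psib [psibG psib_loc psibE]] := extend_to_closure HG sP.
have rpsib : random_elements (@Omega2 R) (left_completion G) (psib \o h).
  apply: (random_local mO psibG) rh => x; exists (s x) => k k'.
  exact: psib_loc.
have d0 : (0 < e / 2 / (2 ^ (pickle tt).+1)%:R)%R.
  by rewrite !divr_gt0 // ltr0n expn_gt0.
have [g rg gh] := approximable_on_seqs n aG rpsib d0.
have [mg Gg] := (random_self_mapP mO _ _).1 rg.
have rphig : random_elements (@Omega2 R) H (phi \o g).
  by apply: (random_local mO GH) rg.
exists (phi \o g) => // f rf; have /random_discreteP mf := rf.
have maf := dmeasurable_comp a mf.
apply: (rv_dist_cover_lt rphig rh rf e0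
  (E := fun _ : unit => disagreement g (psib \o h) (a \o f))).
- by move=> _; exact: measurable_disagreement rg rpsib maf.
- move=> -[].
  by apply: gh => // x; have [] := aP (f x).
move=> w Ow /(_ tt)/(agree_off_disagreement Ow) /= gpsi.
have clh := ((random_self_mapP mO _ _).1 rh).2 w Ow.
have [k Hk hk] := (closureP _ _).1 clh (f w.1 :: flatten (map s (a (f w.1)))).
rewrite hk ?inE ?eqxx //.
rewrite -[in RHS](psiK k) ?inE //.
apply: (aP (f w.1)).2; [exact: Gg|exact: HG|].
move=> x xa; rewrite gpsi //; apply: psibE => // y ys.
by apply: hk; rewrite inE; apply/orP; right; apply/flatten_mapP; exists x.
Qed.

Theorem proposition3p10 (R : realType) :
  (forall (M N : countType) (G : set (self_map M)) (H : set (self_map N)),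
     oligomorphic_permutation_group G -> oligomorphic_permutation_group H ->
     approximable_random_endomorphisms R G ->
     approximable_random_endomorphisms R H ->
     approximable_random_endomorphisms R (direct_product G H) /\
     approximable_random_endomorphisms R (wreath_product G H)) /\
  (forall (M : countType) (G H : set (self_map M)),
     oligomorphic_permutation_group G -> oligomorphic_permutation_group H ->
     finite_index_supergroup G H ->
     approximable_random_endomorphisms R H ->
     approximable_random_endomorphisms R G) /\
  (forall (M N : countType) (G : set (self_map M)) (H : set (self_map N)),
     oligomorphic_permutation_group G -> oligomorphic_permutation_group H ->
     approximable_random_endomorphisms R G ->
     topologically_isomorphic G H ->
     approximable_random_endomorphisms R H).
Proof.
split=> [M N G H [pG _] [pH _] aG aH|].
  split; first exact: approximable_direct_product.
  exact: approximable_wreath_product.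
split=> [M G H oG _|M N G H _ oH aG GH].
  exact: approximable_finite_index.
exact: approximable_isomorphic GH aG.
Qed.
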